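(* Let $\{\mathfrak{M}_n\}_{n=0}^{\infty}$ be a Schauder-Orlicz decomposition with an Orlicz function $\Phi$ of a Banach space $X$. Then the following is true. (1) $\{\mathfrak{M}_n\}_{n=0}^{\infty}$ is monotone. (2) For any $n,m$ and all $x_{i_j}\in\mathfrak{M}_{i_j}$ $(j=0,\ldots,n)$, $x_{l_j}\in\mathfrak{M}_{l_j}$ $(j=0,\ldots,m)$ satisfying $\{i_0,\ldots,i_n\}\cap\{l_0,\ldots,l_m\}=\emptyset$, we have $$\left\|\sum_{j=0}^{n}x_{i_j}\right\|\le\left\|\sum_{j=0}^{n}x_{i_j}+\sum_{j=0}^{m}x_{l_j}\right\|$$ (i.e. $\{\mathfrak{M}_n\}_{n=0}^{\infty}$ is Singer-orthogonal). (3) For any $n,m$ such that $n\ne m$ we have $(\widehat{\mathfrak{M}_n,\mathfrak{M}_m})=1$. (4) For any $n\ge 0$ and $m\ge 1$ we have $(\widehat{\mathfrak{G}_n,\mathfrak{L}_{n,m}})=1$, where $\mathfrak{G}_n=\overline{\mathrm{Lin}}\{\mathfrak{M}_0,\ldots,\mathfrak{M}_n\}$ and $\mathfrak{L}_{n,m}=\overline{\mathrm{Lin}}\{\mathfrak{M}_{n+1},\ldots,\mathfrak{M}_{n+m}\}$. Thus $\gamma(\{\mathfrak{M}_n\}_{n=0}^{\infty})=1$, i.e. $\{\mathfrak{M}_n\}_{n=0}^{\infty}$ is orthogonal.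
   Context: A Schauder decomposition of a Banach space $X$ is a sequence $\{\mathfrak{M}_n\}_{n=0}^{\infty}$ of closed nonzero linear subspaces of $X$ such that each $x\in X$ has a unique norm convergent expansion $x=\sum_{n=0}^{\infty}x_n$ with $x_n\in\mathfrak{M}_n$ for all $n$. Its associated sequence of coordinate projections (a.s.c.p.) $\{P_n\}_{n=0}^{\infty}$ is defined by $P_nx=x_n$; each $P_n$ is bounded. An Orlicz function is a continuous, nondecreasing, convex function $\Phi:[0,\infty)\to[0,\infty)$ with $\Phi(0)=0$ and $\lim_{t\to\infty}\Phi(t)=\infty$ (it may be degenerate, i.e. $\Phi(t)=0$ for some $t>0$). A Schauder decomposition of $X$ with a.s.c.p. $\{P_n\}$ is a Schauder-Orlicz decomposition with Orlicz function $\Phi$ if for every $x\in X$: $\inf\{\rho>0:\sum_{n=0}^{\infty}\Phi(\|P_nx\|/\rho)\le 1\}=\|x\|$. A Schauder decomposition is monotone if $\|\sum_{j=0}^{n}y_j\|\le\|\sum_{j=0}^{n+m}y_j\|$ for all $n,m$ and all $y_j\in\mathfrak{M}_j$, $j=0,\ldots,n+m$. For subspaces $\mathfrak{M},\mathfrak{N}$ of $X$ the inclination of $\mathfrak{M}$ to $\mathfrak{N}$ is $(\widehat{\mathfrak{M},\mathfrak{N}})=\inf\{\|x-y\|:x\in\mathfrak{M},\,y\in\mathfrak{N},\,\|x\|=1\}$. $\overline{\mathrm{Lin}}$ denotes closed linear span. The index $\gamma(\{\mathfrak{M}_n\}_{n=0}^{\infty})$ is the supremum of all $\delta$ such that $(\widehat{\mathfrak{G}_n,\mathfrak{L}_{n,m}})\ge\delta$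 for all $n\ge0$, $m\ge1$; the sequence is called orthogonal (in the sense of Grinblyum-James) if its index equals $1$. *)

(* Defs.v *)
From HB Require Import structures.
From mathcomp Require Import all_boot all_order all_algebra.
From mathcomp Require Import all_classical all_reals all_analysis.
From mathcomp Require Import complex.
Set Implicit Arguments.
Unset Strict Implicit.
Unset Printing Implicit Defensive.
Import Order.TTheory GRing.Theory Num.Theory.
Import numFieldNormedType.Exports.
Local Open Scope classical_set_scope.
Local Open Scope ring_scope.

(* A Banach space is a [completeNormedModType (scalar_field R s)], where [s]
   selects real or complex scalars over [R : realType]. *)
Variant scalars := RealScalars | ComplexScalars.

Definition scalar_field (R : realType) (s : scalars) : numFieldType :=
  match s with
  | RealScalars => R
  | ComplexScalars => R[i]
  end.

Definition real_part (R : realType) (s : scalars) : scalar_field R s -> R :=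
  match s return scalar_field R s -> R with
  | RealScalars => fun a => a
  | ComplexScalars => fun a => complex.Re a
  end.

(* The library norm of a normed module takes its values in the scalar field, so
   in the complex case it is a complex number with zero imaginary part. *)
Definition rnorm (R : realType) (s : scalars)
  (X : normedModType (scalar_field R s)) (x : X) : R := real_part `|x|.

Section OrliczFunctions.
Context {R : realType}.
Implicit Type Phi : R -> R.

(* Only the values of [Phi] on [0, +oo[ matter. *)
Definition orlicz_function Phi : Prop :=
  [/\ {in `[0, +oo[, forall t, 0 <= Phi t},
      {within `[0, +oo[, continuous Phi},
      {in `[0, +oo[ &, {homo Phi : t u / t <= u}},
      convex_function (`[0, +oo[%classic : set R) Phi &
      Phi 0 = 0 /\ Phi t @[t --> +oo] --> +oo].

End OrliczFunctions.

Section Decompositions.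
Context {R : realType} {s : scalars}.
Context {X : completeNormedModType (scalar_field R s)}.
Implicit Types (A B : set X) (M : nat -> set X) (Phi : R -> R).

Definition linear_subspace A : Prop := submod_closed [pred x | x \in A].

Definition lin A : set X := smallest linear_subspace A.

Definition expansion M (x : X) (u : nat -> X) : Prop :=
  (forall n, M n (u n)) /\ series u @ \oo --> x.

Definition schauder_decomposition M : Prop :=
  [/\ forall n, linear_subspace (M n),
      forall n, closed (M n),
      forall n, exists2 x, M n x & x != 0 &
      forall x, exists! u : nat -> X, expansion M x u].

(* For a Schauder decomposition the chosen expansion is the unique one; the
   default value 0 is only used when [x] has no expansion. *)
Definition ascp M (n : nat) (x : X) : X := xget (fun=> 0) (expansion M x) n.

(* The infimum is taken in the extended reals, so that it is +oo when no
   [rho] is admissible. *)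
Definition schauder_orlicz_decomposition M Phi : Prop :=
  schauder_decomposition M /\
  forall x : X,
    ereal_inf [set rho%:E | rho in [set rho : R | 0 < rho /\
      (\sum_(0 <= n <oo) (Phi (rnorm (ascp M n x) / rho))%:E <= 1)%E]]
    = (rnorm x)%:E.

Definition monotone_decomposition M : Prop :=
  forall (n m : nat) (y : nat -> X),
    (forall j, (j <= n + m)%N -> M j (y j)) ->
    rnorm (\sum_(0 <= j < n.+1) y j) <= rnorm (\sum_(0 <= j < (n + m).+1) y j).

Definition singer_orthogonal M : Prop :=
  forall (n m : nat) (i : 'I_n.+1 -> nat) (l : 'I_m.+1 -> nat)
    (x : 'I_n.+1 -> X) (y : 'I_m.+1 -> X),
    (forall j, M (i j) (x j)) -> (forall j, M (l j) (y j)) ->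
    range i `&` range l = set0 ->
    rnorm (\sum_(j < n.+1) x j)
      <= rnorm (\sum_(j < n.+1) x j + \sum_(j < m.+1) y j).

Definition inclination A B : \bar R :=
  ereal_inf [set r | exists x y : X,
    [/\ A x, B y, rnorm x = 1 & r = (rnorm (x - y))%:E]].

Definition closed_lin A : set X := closure (lin A).

Definition head_space M (n : nat) : set X :=
  closed_lin (\bigcup_(k in [set k | (k <= n)%N]) M k).

Definition next_space M (n m : nat) : set X :=
  closed_lin (\bigcup_(k in [set k | (n < k <= n + m)%N]) M k).

Definition gamma_index M : \bar R :=
  ereal_sup [set delta%:E | delta in [set delta : R |
    forall n m : nat, (1 <= m)%N ->
      (delta%:E <= inclination (head_space M n) (next_space M n m))%E]].

(* In the sense of Grinblyum-James. *)
Definition gj_orthogonal M : Prop := gamma_index M = 1%E.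

End Decompositions.

(* Main.v *)
Require Import Defs.
From mathcomp Require Import all_boot all_order all_algebra.
From mathcomp Require Import all_classical all_reals all_analysis.
From mathcomp Require Import complex.
Set Implicit Arguments.
Unset Strict Implicit.
Unset Printing Implicit Defensive.
Import Order.TTheory GRing.Theory Num.Theory.
Import numFieldNormedType.Exports.
Local Open Scope classical_set_scope.
Local Open Scope ring_scope.

(** The Orlicz condition recovers the norm of [x] from the numbers
    [rnorm (P_n x)] alone, and does so monotonically: since [Phi] is
    nondecreasing, shrinking the components enlarges the set of admissible
    [rho] and hence shrinks the infimum ([rnorm_le_expansion]).

    All the conclusions are instances of one consequence.  For a set [K] of
    indices let [spectral_subspace M K] be the vectors whose expansion is
    supported in [K].  If [K] and [L] are disjoint, [x] has support in [K] and
    [y] has support in [L], then each component of [x] is either zero or equal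
    to the corresponding component of [x + y], so [`|x| <= `|x + y|]
    ([spectral_norm_le]).  Monotonicity takes [K] to be an initial segment and
    [L] its complement; Singer orthogonality takes for [K] and [L] the ranges
    of the two families of indices.

    For the inclinations, the inequality says that [rnorm (x - y) >= 1] for
    unit vectors [x], and the value 1 is attained at [y = 0]
    ([inclination_eq1]).  Spectral subspaces are linear, so they contain the
    algebraic span of the [M k], [k] in [K]; since the inequality is closed in
    the pair [(x, y)], it extends to the closed spans ([closed_lin_norm_le])
    without determining what these closures are. *)

(** * Real-valued norms *)

Section RealNorm.
Context {R : realType} {s : scalars} {X : normedModType (scalar_field R s)}.

(** The norm of the module is a nonnegative scalar, and nonnegative complex
    numbers are ordered by their real parts, so nothing is lost by passing to
    [rnorm]. *)
Lemma rnorm_le (x y : X) : (rnorm x <= rnorm y) = (`|x| <= `|y|).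
Proof.
rewrite /rnorm; have := normr_ge0 x; have := normr_ge0 y.
move: `|x| `|y|; case: (s) => //= a b.
by rewrite !lecE /= => /andP[/eqP-> _] /andP[/eqP-> _]; rewrite eqxx.
Qed.

Lemma rnorm_ge0 (x : X) : 0 <= rnorm x.
Proof.
rewrite /rnorm; have := normr_ge0 x.
move: `|x|; case: (s) => //= a.
by rewrite lecE /= => /andP[].
Qed.

Lemma rnorm0 : rnorm (0 : X) = 0.
Proof. by rewrite /rnorm normr0; case: (s). Qed.

Lemma rnorm_unit (x : X) : `|x| = 1 -> rnorm x = 1.
Proof. by rewrite /rnorm => ->; case: (s). Qed.

End RealNorm.

(** * Expansions and their supports *)

Section Spectral.
Context {R : realType} {s : scalars}.
Context {X : completeNormedModType (scalar_field R s)}.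
Implicit Types (A B : set X) (M : nat -> set X) (K L : set nat) (x y : X).

Lemma linear_subspace0 A : linear_subspace A -> A 0.
Proof. by move=> -[+ _]; rewrite !inE. Qed.

Lemma linear_subspaceP A a x y :
  linear_subspace A -> A x -> A y -> A (a *: x + y).
Proof.
move=> -[_ lA] Ax Ay.
by have := lA a x y; rewrite !inE; apply.
Qed.

Lemma linear_subspaceZ A a x : linear_subspace A -> A x -> A (a *: x).
Proof.
by move=> sA Ax; rewrite -[_ *: _]addr0; apply: linear_subspaceP => //;
   exact: linear_subspace0.
Qed.

Lemma linear_subspaceN A x : linear_subspace A -> A x -> A (- x).
Proof. by rewrite -scaleN1r; exact: linear_subspaceZ. Qed.

Lemma linear_subspace_sum A (I : Type) (r : seq I) (P : pred I) (F : I -> X) :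
  linear_subspace A -> (forall i, P i -> A (F i)) ->
  A (\sum_(i <- r | P i) F i).
Proof.
move=> sA AF; elim/big_ind: _ => //; first exact: linear_subspace0.
by move=> x y Ax Ay; rewrite -[x]scale1r; exact: linear_subspaceP.
Qed.

Lemma expansion_linear M a x y (u v : nat -> X) :
  (forall n, linear_subspace (M n)) -> expansion M x u -> expansion M y v ->
  expansion M (a *: x + y) (fun n => a *: u n + v n).
Proof.
move=> sM [Mu ux] [Mv vy]; split; first by move=> n; exact: linear_subspaceP.
have -> : series (fun n => a *: u n + v n) = (a \*: series u) + series v.
  by apply/funext => n; rewrite /series /= big_split /= -scaler_sumr.
by apply: cvgD => //; exact: cvgZl_tmp.
Qed.

Lemma expansion_single M k x :
  (forall n, linear_subspace (M n)) -> M k x ->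
  expansion M x (fun n => if n == k then x else 0).
Proof.
move=> sM Mx; split.
  by move=> n; case: eqP => [->|_] //; exact: linear_subspace0.
apply: cvg_near_cst; exists k.+1 => // n /= kn.
by rewrite /series /= -big_mkcond big_nat1_eq kn.
Qed.

Lemma ascpE M x (u : nat -> X) :
  schauder_decomposition M -> expansion M x u -> (ascp M)^~ x = u.
Proof.
case=> _ _ _ /(_ x)[w [_ uniq_w]] xu; apply/funext => n.
rewrite /ascp (xget_unique _ xu) // => v xv.
by rewrite -(uniq_w _ xv) -(uniq_w _ xu).
Qed.

Definition spectral_subspace M K : set X :=
  [set x | exists2 u, expansion M x u & forall n, ~ K n -> u n = 0].

Lemma spectral_linear M K :
  (forall n, linear_subspace (M n)) -> linear_subspace (spectral_subspace M K).
Proof.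
move=> sM; split=> [|a x y]; rewrite !inE.
  exists (fun n => if n == 0%N then 0 else 0); last by move=> n _; case: ifP.
  by apply: expansion_single => //; exact: linear_subspace0.
move=> [u xu u0] [v yv v0]; exists (fun n => a *: u n + v n).
  exact: expansion_linear.
by move=> n nK; rewrite u0 // v0 // scaler0 addr0.
Qed.

Lemma sub_spectral M K k :
  (forall n, linear_subspace (M n)) -> K k -> M k `<=` spectral_subspace M K.
Proof.
move=> sM Kk x Mx; eexists; first exact: expansion_single Mx.
by move=> n nK /=; case: (n =P k) => // nk; case: nK; rewrite nk.
Qed.

Lemma lin_sub_spectral M K :
  (forall n, linear_subspace (M n)) ->
  lin (\bigcup_(k in K) M k) `<=` spectral_subspace M K.
Proof.
move=> sM; apply: smallest_sub; first exact: spectral_linear.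
by move=> x [k Kk]; exact: sub_spectral.
Qed.

(** * Orthogonality in a Schauder-Orlicz decomposition *)

Section SchauderOrlicz.
Context (M : nat -> set X) (Phi : R -> R).
Context (orliczPhi : orlicz_function Phi)
  (soM : schauder_orlicz_decomposition M Phi).

Let sM n : linear_subspace (M n). Proof. by case: soM => -[]. Qed.

(** Any [rho] admissible for [y] is admissible for [x], because [Phi] is
    nondecreasing. *)
Lemma rnorm_le_expansion x y (u v : nat -> X) :
  expansion M x u -> expansion M y v ->
  (forall n, rnorm (u n) <= rnorm (v n)) -> `|x| <= `|y|.
Proof.
move=> xu yv uv; have [dM normM] := soM.
have [Phi_ge0 _ Phi_homo _ _] := orliczPhi.
have au n : ascp M n x = u n by rewrite -(ascpE dM xu).
have av n : ascp M n y = v n by rewrite -(ascpE dM yv).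
rewrite -rnorm_le -lee_fin -(normM x) -(normM y).
apply: ereal_inf_le_tmp => _ [rho [rho_gt0 sum_le1] <-].
exists rho => //; split=> //; apply: le_trans sum_le1.
have pos z : rnorm z / rho \in (`[0, +oo[ : interval R).
  by rewrite in_itv /= andbT divr_ge0 ?rnorm_ge0 // ltW.
apply: lee_nneseries => n _; first by rewrite lee_fin Phi_ge0.
by rewrite lee_fin au av Phi_homo // ler_pM2r ?invr_gt0.
Qed.

Lemma spectral_norm_le K L x y :
  (forall n, K n -> ~ L n) ->
  spectral_subspace M K x -> spectral_subspace M L y -> `|x| <= `|x + y|.
Proof.
move=> KL [u xu u0] [v yv v0].
have xyuv := expansion_linear 1 sM xu yv; rewrite scale1r in xyuv.
apply: (rnorm_le_expansion xu xyuv) => n; rewrite scale1r.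
have [Kn|nKn] := pselect (K n); first by rewrite v0 ?addr0 //; exact: KL.
by rewrite u0 // rnorm0 rnorm_ge0.
Qed.

(** Approximate [x] and [y] within a third of [e] by vectors of the algebraic
    spans, where the inequality is known. *)
Lemma closed_lin_norm_le K L x y :
  (forall n, K n -> ~ L n) ->
  closed_lin (\bigcup_(k in K) M k) x -> closed_lin (\bigcup_(k in L) M k) y ->
  `|x| <= `|x - y|.
Proof.
move=> KL clx cly; apply/ler_addgt0Pr => e e_gt0.
have e3_gt0 : 0 < e / 3%:R by rewrite divr_gt0 // ltr0n.
have [x' [/lin_sub_spectral-/(_ sM) Kx']] := clx _ (nbhsx_ballx x _ e3_gt0).
have [y' [/lin_sub_spectral-/(_ sM) Ly']] := cly _ (nbhsx_ballx y _ e3_gt0).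
rewrite -!ball_normE /= => /ltW yy' /ltW xx'.
have x'y' : `|x'| <= `|x' - y'|.
  apply: (spectral_norm_le KL Kx').
  by apply: linear_subspaceN Ly'; exact: spectral_linear.
have -> : e = e / 3%:R + (e / 3%:R + e / 3%:R).
  by rewrite -mulr2n -mulrS -(mulr_natr (e / _)) divfK // pnatr_eq0.
have -> : x = (x - x') + x' by rewrite subrK.
apply: le_trans (ler_normD _ _) _; rewrite addrCA lerD // subrK.
apply: le_trans x'y' _.
have -> : x' - y' = (x - y) + ((y - y') - (x - x')).
  by rewrite opprB addrA [x - y + _]addrA subrK addrC addrA subrK.
apply: le_trans (ler_normD _ _) _; rewrite lerD //.
by apply: le_trans (ler_normB _ _) _; rewrite lerD.
Qed.

Lemma schauder_unit_vector n : exists2 x, M n x & rnorm x = 1.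
Proof.
have [[_ _ /(_ n)[x Mx x0] _] _] := soM.
exists (`|x|^-1 *: x); first exact: linear_subspaceZ.
by apply: rnorm_unit; rewrite normrZ normfV normr_id mulVf // normr_eq0.
Qed.

End SchauderOrlicz.

Lemma inclination_eq1 A B :
  (exists2 x, A x & rnorm x = 1) -> B 0 ->
  (forall x y, A x -> B y -> `|x| <= `|x - y|) -> inclination A B = 1%E.
Proof.
move=> [x Ax x1] B0 AB; apply/eqP; rewrite eq_le; apply/andP; split.
  apply: ereal_inf_lbound; exists x, 0; split=> //.
  by rewrite subr0 x1.
apply/ereal_infP => _ [{}x [y [{}Ax By {}x1 ->]]].
by rewrite lee_fin -x1 rnorm_le AB.
Qed.

Lemma sub_closed_lin A : A `<=` closed_lin A.
Proof.
by apply: subset_trans (@subset_closure _ _); exact: sub_gen_smallest.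
Qed.

End Spectral.

Theorem theorem14 (R : realType) (s : scalars)
    (X : completeNormedModType (scalar_field R s))
    (M : nat -> set X) (Phi : R -> R)
    (orliczPhi : orlicz_function Phi)
    (soM : schauder_orlicz_decomposition M Phi) :
  [/\ monotone_decomposition M,
      singer_orthogonal M,
      forall n m : nat, n <> m -> inclination (M n) (M m) = 1%E &
      (forall n m : nat, (1 <= m)%N ->
         inclination (head_space M n) (next_space M n m) = 1%E) /\
      gj_orthogonal M].
Proof.
have sM n : linear_subspace (M n) by case: soM => -[].
have specL K := spectral_linear K sM.
have incl_next n m : (1 <= m)%N ->
    inclination (head_space M n) (next_space M n m) = 1%E.
  move=> m_ge1; apply: inclination_eq1.
  - have [x Mx x1] := schauder_unit_vector soM 0.
    by exists x => //; apply: sub_closed_lin; exists 0%N.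
  - apply: sub_closed_lin; exists n.+1; last exact: linear_subspace0.
    by rewrite /= ltnSn -addn1 leq_add2l.
  - move=> x y; apply: (closed_lin_norm_le orliczPhi soM) => k /= kn.
    by rewrite ltnNge kn.
split.
- move=> n m y My; rewrite rnorm_le.
  rewrite (@big_cat_nat _ _ _ n.+1 0 (n + m).+1) ?ltnS ?leq_addr //=.
  apply: (spectral_norm_le orliczPhi soM (K := [set k | (k <= n)%N])
           (L := [set k | (n < k)%N])) => [k /= kn||]; first by rewrite ltnNge kn.
  + rewrite big_nat; apply: linear_subspace_sum => // k; rewrite ltnS => kn.
    by apply: sub_spectral (My k _) => //; exact: leq_trans kn (leq_addr _ _).
  + rewrite big_nat; apply: linear_subspace_sum => // k /andP[nk km].
    exact: sub_spectral (My k _).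
- move=> n m i l x y Mx My il0; rewrite rnorm_le.
  apply: (spectral_norm_le orliczPhi soM (K := range i) (L := range l)).
  + by move=> k ik lk; have : set0 k by rewrite -il0.
  + apply: linear_subspace_sum => // j _.
    by apply: sub_spectral (Mx j) => //; exists j.
  + apply: linear_subspace_sum => // j _.
    by apply: sub_spectral (My j) => //; exists j.
- move=> n m nm; apply: inclination_eq1.
  + exact: schauder_unit_vector soM n.
  + exact: linear_subspace0.
  + move=> x y Mx My.
    apply: (spectral_norm_le orliczPhi soM (K := [set n]) (L := [set m])).
    * by move=> _ -> /nm.
    * exact: sub_spectral Mx.
    * by apply: linear_subspaceN => //; exact: sub_spectral My.
- split=> //; rewrite /gj_orthogonal /gamma_index.
  apply/eqP; rewrite eq_le; apply/andP; split.
    apply/ereal_supP => _ [d /(_ 0%N 1%N isT) d1 <-].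
    by rewrite incl_next in d1.
  by apply: ereal_sup_ubound; exists 1 => // n m /incl_next ->.
Qed.
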